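(* Let $\mathbb{F}$ be a field of characteristic zero, let $S_2$ be the 4-dimensional $\mathbb{F}$-algebra with basis $e_1,\dots,e_4$ defined in the context, and let $Ann_l(S_2)$ be the linear span of $e_4$. If $I$ is a non-trivial right ideal of $S_2$, then $I$ is a subspace of $Ann_l(S_2)$.
   Context: Let $V_2$ be a 2-dimensional vector space over $\mathbb{F}$ with basis $v_1,v_2$. $W(2)$ is the vector space of all bilinear maps $V_2\times V_2\to V_2$ with the (not necessarily associative, not necessarily unital) product $$(A\cdot B)(x,y)=A(v_1,B(x,y))-B(A(v_1,x),y)-B(x,A(v_1,y)),\qquad x,y\in V_2.$$ For $i,j,k\in\{1,2\}$ let $\alpha_{ij}^k\in W(2)$ be given by $\alpha_{ij}^k(v_t,v_l)=\delta_{it}\delta_{jl}v_k$. Put $e_1=\alpha_{11}^1-\alpha_{12}^2-\alpha_{21}^2$, $e_2=\alpha_{11}^2$, $e_3=\alpha_{22}^2-\alpha_{12}^1-\alpha_{21}^1$, $e_4=\alpha_{22}^1$. $S_2$ is the subalgebra of $W(2)$ with basis $e_1,\dots,e_4$ (it consists of the commutative bilinear maps with trace zero multiplication operators). A right ideal of an algebra $W$ is a subspace $I$ with $IW\subseteq I$; it is non-trivial if $I\neq 0$ and $I\neq W$. *)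

(* Defs.v *)
From HB Require Import structures.
From mathcomp Require Import all_boot all_order all_algebra.
Set Implicit Arguments.
Unset Strict Implicit.
Unset Printing Implicit Defensive.
Import GRing.Theory.
Local Open Scope ring_scope.

(* Bilinear maps V * V -> V are represented in curried form; this type has a
   canonical vectType structure, with the pointwise operations. *)
Notation bilinear_map V := ('Hom(V, 'Hom(V, V))).

Section BilinearMap.
Variables (F : fieldType) (V : vectType F).

(* linfun only agrees with its argument when the latter is linear; bilfunE
   discharges this, and alphaE and W2mulE below apply it. *)
Definition bilfun (f : V -> V -> V) : bilinear_map V :=
  linfun (fun x => linfun (f x)).

Lemma bilfunE (f : V -> V -> V) :
  (forall x, linear (f x)) -> (forall y, linear (f^~ y)) ->
  forall x y, bilfun f x y = f x y.
Proof.
move=> linr linl x y.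
have E x' y' : linfun (f x') y' = f x' y'.
  pose g : {linear V -> V} :=
    HB.pack (f x') (GRing.isLinear.Build F V V *:%R (f x') (linr x')).
  exact: (lfunE g).
have lin : linear (fun x' => linfun (f x')).
  by move=> a u v; apply/lfunP => z; rewrite !lfunE /= !lfunE /= !E linl.
pose h : {linear V -> 'Hom(V, V)} :=
  HB.pack (fun x' => linfun (f x'))
    (GRing.isLinear.Build F V 'Hom(V, V) *:%R _ lin).
by rewrite /bilfun (lfunE h) /= E.
Qed.

End BilinearMap.

Definition right_ideal (F : fieldType) (W : vectType F) (mul : W -> W -> W)
    (S I : {vspace W}) : Prop :=
  (I <= S)%VS /\ (forall a s, a \in I -> s \in S -> mul a s \in I).

Definition nontrivial_in (F : fieldType) (W : vectType F)
    (S I : {vspace W}) : Prop :=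
  I <> 0%VS /\ I <> S.

(* The basis v_1, v_2 is the pair b; indices are shifted, so that v_1 = b`_0
   and v_2 = b`_1. *)
Section W2.
Variables (F : fieldType) (V : vectType F) (b : 2.-tuple V).

Definition W2mul (A B : bilinear_map V) : bilinear_map V :=
  bilfun (fun x y => A b`_0 (B x y) - B (A b`_0 x) y - B x (A b`_0 y)).

Definition alpha (i j k : 'I_2) : bilinear_map V :=
  bilfun (fun x y => (coord b i x * coord b j y) *: b`_k).

Local Notation i1 := (0 : 'I_2).
Local Notation i2 := (1 : 'I_2).

Definition e1 := alpha i1 i1 i1 - alpha i1 i2 i2 - alpha i2 i1 i2.
Definition e2 := alpha i1 i1 i2.
Definition e3 := alpha i2 i2 i2 - alpha i1 i2 i1 - alpha i2 i1 i1.
Definition e4 := alpha i2 i2 i1.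

Definition S2 : {vspace bilinear_map V} := <<[:: e1; e2; e3; e4]>>%VS.

Definition Ann_l_S2 : {vspace bilinear_map V} := <[e4]>%VS.

Lemma W2mulE (A B : bilinear_map V) x y :
  W2mul A B x y = A b`_0 (B x y) - B (A b`_0 x) y - B x (A b`_0 y).
Proof.
have E (k : F) (p q r p' q' r' : V) : k *: p + p' - (k *: q + q') -
    (k *: r + r') = k *: (p - q - r) + (p' - q' - r').
  by rewrite !scalerBr !opprD (AC (2*2*2) ((1*3*5)*(2*4*6))).
rewrite /W2mul bilfunE // => z k u v /=; rewrite -E.
  by rewrite !linearP.
do 3! rewrite ?linearP /= ?add_lfunE ?scale_lfunE.
by [].
Qed.

Lemma alphaE (b_basis : basis_of fullv b) (i j k t l : 'I_2) :
  alpha i j k b`_t b`_l = ((i == t)%:R * (j == l)%:R) *: b`_k.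
Proof.
have b_free := basis_free b_basis.
rewrite [i == t]eq_sym [j == l]eq_sym.
rewrite /alpha bilfunE ?coord_free // => z k' u v; rewrite linearP.
  by rewrite mulrDr scalerDl scalerA mulrCA.
by rewrite mulrDl scalerDl scalerA mulrA.
Qed.

End W2.

(* Main.v *)
(* A . B only depends on A through the operator A(v_1, .); this gives a Lie
   algebra sl_2 acting on S_2, with e1, e2, e3 acting as multiples of h, f, e
   and e4 acting as 0. A right ideal not inside the span of e4 contains, after
   at most one more multiplication by e2 or e3, an element x e1 + y e2 + t e4
   with x nonzero; its right multiples span S_2 because h acts invertibly. *)
From HB Require Import structures.
Require Import Defs.
From mathcomp Require Import all_boot all_order all_algebra.
Set Implicit Arguments.
Unset Strict Implicit.
Unset Printing Implicit Defensive.
Local Open Scope ring_scope.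
Import GRing.Theory.

Lemma basis_lfun_eq (F : fieldType) (V W : vectType F) (n : nat)
    (b : n.-tuple V) (f g : 'Hom(V, W)) :
  basis_of fullv b -> (forall i : 'I_n, f b`_i = g b`_i) -> f = g.
Proof.
move=> b_basis fg; apply/lfunP => x.
rewrite (coord_basis b_basis (memvf x)) !linear_sum /=.
by apply: eq_bigr => i _; rewrite !linearZ /= fg.
Qed.

Section MultiplicationTable.
Variables (F : fieldType) (V : vectType F) (b : 2.-tuple V).
Hypothesis b_basis : basis_of fullv b.

Local Notation mul := (W2mul b).
Local Notation e1 := (e1 b).
Local Notation e2 := (e2 b).
Local Notation e3 := (e3 b).
Local Notation e4 := (e4 b).

Lemma bilinear_map_eq (A B : bilinear_map V) :
  A b`_0 b`_0 = B b`_0 b`_0 -> A b`_0 b`_1 = B b`_0 b`_1 ->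
  A b`_1 b`_0 = B b`_1 b`_0 -> A b`_1 b`_1 = B b`_1 b`_1 -> A = B.
Proof.
move=> AB00 AB01 AB10 AB11.
apply: (basis_lfun_eq b_basis) => -[[|[|//]] ? /=];
  by apply: (basis_lfun_eq b_basis) => -[[|[|//]] ? /=].
Qed.

Lemma W2mul_linearl B : linear (mul^~ B).
Proof.
move=> k A A'; apply/lfunP => x; apply/lfunP => y.
rewrite !(W2mulE, add_lfunE, scale_lfunE) /=.
rewrite !linearP /= ?(add_lfunE, scale_lfunE) !scalerBr scalerN !opprD.
by rewrite (AC (2*2*2) ((1*3*5)*(2*4*6))).
Qed.

Lemma W2mul_combl (x y z t : F) (B : bilinear_map V) :
  mul (x *: e1 + y *: e2 + z *: e3 + t *: e4) B =
  x *: mul e1 B + y *: mul e2 B + z *: mul e3 B + t *: mul e4 B.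
Proof.
pose f : {linear bilinear_map V -> bilinear_map V} :=
  HB.pack (mul^~ B) (GRing.isLinear.Build F _ _ *:%R _ (W2mul_linearl B)).
by rewrite -[mul _ B]/(f _) 3!(linearD f) 4!(linearZ_LR f).
Qed.

(** The nested product serves as one rewrite rule for all sixteen values. *)
Lemma eE :
  ((e1 b`_0 b`_0 = b`_0) * (e1 b`_0 b`_1 = - b`_1) *
   (e1 b`_1 b`_0 = - b`_1) * (e1 b`_1 b`_1 = 0)) *
  ((e2 b`_0 b`_0 = b`_1) * (e2 b`_0 b`_1 = 0) *
   (e2 b`_1 b`_0 = 0) * (e2 b`_1 b`_1 = 0)) *
  ((e3 b`_0 b`_0 = 0) * (e3 b`_0 b`_1 = - b`_0) *
   (e3 b`_1 b`_0 = - b`_0) * (e3 b`_1 b`_1 = b`_1)) *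
  ((e4 b`_0 b`_0 = 0) * (e4 b`_0 b`_1 = 0) *
   (e4 b`_1 b`_0 = 0) * (e4 b`_1 b`_1 = b`_0)).
Proof.
(* [alphaE] matches only indices coming from ['I_2], so the natural numbers 0 and 1 are first read
   as ordinals. *)
pose i0 : 'I_2 := 0; pose i1 : 'I_2 := 1.
have -> : b`_0 = b`_i0 by [].
have -> : b`_1 = b`_i1 by [].
rewrite /Defs.e1 /Defs.e2 /Defs.e3 /Defs.e4 !(add_lfunE, opp_lfunE).
by rewrite !(alphaE b_basis) //= !(mul0r, mulr0, mul1r, scale0r, scale1r, subr0, sub0r).
Qed.

Lemma lfunN (U W : vectType F) (f : 'Hom(U, W)) x : f (- x) = - f x.
Proof. exact: linearN. Qed.

Lemma lfun0 (U W : vectType F) (f : 'Hom(U, W)) : f 0 = 0.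
Proof. exact: linear0. Qed.

(* The e_i are abstracted because the lfun rewriting rules would otherwise
   unfold them. *)
Ltac mul_table :=
  let E := fresh in have E := eE; apply: bilinear_map_eq; rewrite W2mulE; move: E;
  move: e1 e2 e3 e4 b`_0 b`_1 => f1 f2 f3 f4 u v E;
  rewrite ?(opp_lfunE, scale_lfunE, zero_lfunE);
  rewrite ?(E, lfunN, lfun0, opp_lfunE, zero_lfunE);
  rewrite ?(opprK, subr0, sub0r, addr0, add0r, oppr0, scaler0, scalerN, scaleNr, scaler_nat,
    addrK, subrK, subrr, mulrS, mulr0n, opprD, addrA).

(** Multiplication by [e1] on the left has weights -3, -1, 1, 3 on [e2], [e1], [e3], [e4], and [e2]
    lowers along the chain [e4], [e3], [e1], [e2], 0 up to scalars. In characteristic zero this is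
    the 4-dimensional irreducible sl_2-module. *)
Lemma mul_e1_e1 : mul e1 e1 = - e1. Proof. by mul_table. Qed.
Lemma mul_e1_e2 : mul e1 e2 = - 3%:R *: e2. Proof. by mul_table. Qed.
Lemma mul_e1_e3 : mul e1 e3 = e3. Proof. by mul_table. Qed.
Lemma mul_e1_e4 : mul e1 e4 = 3%:R *: e4. Proof. by mul_table. Qed.
Lemma mul_e2_e1 : mul e2 e1 = 3%:R *: e2. Proof. by mul_table. Qed.
Lemma mul_e2_e2 : mul e2 e2 = 0. Proof. by mul_table. Qed.
Lemma mul_e2_e3 : mul e2 e3 = 2%:R *: e1. Proof. by mul_table. Qed.
Lemma mul_e2_e4 : mul e2 e4 = e3. Proof. by mul_table. Qed.
Lemma mul_e3_e2 : mul e3 e2 = - e1. Proof. by mul_table. Qed.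

Lemma mul_e4 B : mul e4 B = 0.
Proof.
have e40 : e4 b`_0 = 0.
  by apply: (basis_lfun_eq b_basis) => -[[|[|//]] ? /=]; rewrite eE zero_lfunE.
apply/lfunP => x; apply/lfunP => y.
by rewrite W2mulE e40 !zero_lfunE !lfun0 zero_lfunE !subr0.
Qed.

Lemma S2_coords A : A \in S2 b ->
  exists x y z t : F, A = x *: e1 + y *: e2 + z *: e3 + t *: e4.
Proof.
rewrite /S2 !span_cons span_nil addv0.
case/memv_addP=> _ /vlineP[x ->] [_ /memv_addP[_ /vlineP[y ->] [B BS ->]] ->].
case/memv_addP: BS => _ /vlineP[z ->] [_ /vlineP[t ->] ->].
by exists x, y, z, t; rewrite !addrA.
Qed.

Lemma mem_S2 : [/\ e1 \in S2 b, e2 \in S2 b, e3 \in S2 b & e4 \in S2 b].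
Proof. by split; rewrite memv_span // !inE eqxx ?orbT. Qed.

Section RightIdeal.
Hypothesis char0 : [pchar F] =i pred0.
Variable I : {vspace bilinear_map V}.
Hypothesis I_right_ideal : right_ideal mul (S2 b) I.

(** Characteristic zero enters here, to divide by 2 and 3; because of the successor, [natF_neq0 2]
    is about 3. *)
Let natF_neq0 n : n.+1%:R != 0 :> F.
Proof. by rewrite ((pcharf0P F).1 char0). Qed.

Let memvZ_neq0 (k : F) (A : bilinear_map V) : k != 0 -> k *: A \in I -> A \in I.
Proof. by move=> k0; rewrite rpredZeq (negPf k0). Qed.

(* The operator B |-> A . B for A = x e1 + y e2 + t e4 is triangular in
   e2, e1, e3, e4, with diagonal (-3x, -x, x, 3x). *)
Lemma right_ideal_full_triangular (x y t : F) :
  x != 0 -> x *: e1 + y *: e2 + t *: e4 \in I -> I = S2 b.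
Proof.
case: I_right_ideal => I_sub I_mul x0 AI; have [S1 S2' S3 S4] := mem_S2.
have AM B : B \in S2 b -> x *: mul e1 B + y *: mul e2 B \in I.
  move=> /(I_mul _ _ AI); have := W2mul_combl x y 0 t B.
  by rewrite scale0r addr0 => ->; rewrite mul_e4 scale0r scaler0 !addr0.
(* Back-substitution in the triangular order: the [y] term of each product is zero or a multiple of
   the vector just obtained, so the diagonal term lies in [I]. *)
have I2 : e2 \in I.
  move: (AM _ S2'); rewrite mul_e1_e2 mul_e2_e2 scaler0 addr0 scaleNr scalerN.
  by rewrite memvN => /(memvZ_neq0 x0)/(memvZ_neq0 (natF_neq0 2)).
have I1 : e1 \in I.
  move: (AM _ S1); rewrite mul_e1_e1 mul_e2_e1 rpredDr; last by rewrite !memvZ.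
  by rewrite scalerN memvN => /(memvZ_neq0 x0).
have I3 : e3 \in I.
  move: (AM _ S3); rewrite mul_e1_e3 mul_e2_e3 rpredDr; last by rewrite !memvZ.
  exact: memvZ_neq0.
have I4 : e4 \in I.
  move: (AM _ S4); rewrite mul_e1_e4 mul_e2_e4 rpredDr; last by rewrite memvZ.
  by move=> /(memvZ_neq0 x0)/(memvZ_neq0 (natF_neq0 2)).
apply/eqP; rewrite eqEsubv I_sub; apply/span_subvP => A.
by rewrite !inE => /or4P[] /eqP->.
Qed.

Lemma right_ideal_full (x y z t : F) :
  x *: e1 + y *: e2 + z *: e3 + t *: e4 \in I ->
  [|| x != 0, y != 0 | z != 0] -> I = S2 b.
Proof.
case: I_right_ideal => _ I_mul AI; have [_ S2' S3 _] := mem_S2.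
have [z0|z_neq0 _] := eqVneq z 0; last first.
  (* Multiplying by [e2] gives [- z *: e1 - (3 * x) *: e2], whose [e1] coefficient is nonzero. *)
  move: (I_mul _ _ AI S2'); rewrite W2mul_combl.
  rewrite mul_e1_e2 mul_e2_e2 mul_e3_e2 mul_e4 !scaler0 !addr0 scalerN -scaleNr.
  rewrite scalerA addrC -[_ + _]addr0 -(scale0r e4).
  by apply: right_ideal_full_triangular; rewrite oppr_eq0.
move: AI; rewrite z0 scale0r addr0.
have [->|x_neq0 AI _] := eqVneq x 0; last exact: right_ideal_full_triangular AI.
rewrite orbF scale0r add0r /= => AI y_neq0.
(* With [x = z = 0], multiplying by [e3] leaves [(2 * y) *: e1]; zero multiples of [e2] and [e4] are
   then added to reach the triangular form. *)
have := W2mul_combl 0 y 0 t e3; rewrite !scale0r add0r addr0.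
move=> mulA; move: (I_mul _ _ AI S3).
rewrite mulA mul_e2_e3 mul_e4 scaler0 add0r !addr0 scalerA -[_ *: _]addr0.
rewrite -(scale0r e2) -[_ + _]addr0 -(scale0r e4).
by apply: right_ideal_full_triangular; rewrite mulf_neq0.
Qed.

End RightIdeal.
End MultiplicationTable.

Theorem lemma5 (F : fieldType) (char0 : [pchar F] =i pred0)
    (V : vectType F) (b : 2.-tuple V) (b_basis : basis_of fullv b)
    (I : {vspace 'Hom(V, 'Hom(V, V))}) :
  right_ideal (W2mul b) (S2 b) I -> nontrivial_in (S2 b) I ->
  (I <= Ann_l_S2 b)%VS.
Proof.
move=> I_ideal [_ I_neqS]; apply/subvP => A AI.
have [x [y [z [t defA]]]] := S2_coords (subvP I_ideal.1 _ AI).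
(* A component of [A] along [e1], [e2] or [e3] would force [I = S2 b], so only [t *: e4]
   survives. *)
rewrite defA in AI *; have [full|] := boolP [|| x != 0, y != 0 | z != 0].
  by case: I_neqS; apply: (right_ideal_full b_basis char0 I_ideal AI).
rewrite !negb_or !negbK => /and3P[/eqP-> /eqP-> /eqP->].
by rewrite !scale0r !add0r; apply/vlineP; exists t.
Qed.
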